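(* Let $\gamma \geq 0$ be an integer. The vector space of nonempty words on $\{0\} \cup [\gamma]$ containing exactly one occurrence of $0$, endowed with the linear operations $\dashv_a, \vdash_a$, $a \in [\gamma]$, satisfying for all such words $u$ and $v$ $$u \dashv_a v := u\, \mathrm{h}_a(v) \qquad \text{and} \qquad u \vdash_a v := \mathrm{h}_a(u)\, v$$ (concatenation of words), is the free $\gamma$-pluriassociative algebra over one generator.
   Context: The ground field has characteristic zero; $[\gamma] = \{1, \dots, \gamma\}$. For a word $u$ and $a \in [\gamma]$, $\mathrm{h}_a(u)$ is the word obtained by replacing in $u$ every occurrence of a letter smaller than $a$ by $a$. The vector space in question is the linear span of the words considered. A $\gamma$-pluriassociative algebra is a vector space with binary linear operations $\dashv_a, \vdash_a$, $a \in [\gamma]$, satisfying for all elements $x, y, z$ and all $a, a' \in [\gamma]$ (with $a \uparrow a' := \max(a, a')$): $(x \vdash_{a'} y) \dashv_a z = x \vdash_{a'} (y \dashv_a z)$; $(x \dashv_{a \uparrow a'} y) \dashv_a z = x \dashv_a (y \vdash_{a'} z)$; $(x \dashv_{a'} y) \vdash_a z = x \vdash_a (y \vdash_{a \uparrow a'} z)$; $(x \dashv_a y) \dashv_{a \uparrow a'} z = x \dashv_a (y \dashv_{a'} z)$; $(x \vdash_{a'} y) \vdash_a z = x \vdash_{a \uparrow a'} (y \vdash_a z)$. Equivalently, it is an algebra over the operad $\mathsf{Dias}_\gamma$, the operad of words on $\{0\} \cup [\gamma]$ with exactly one $0$ with $u \circ_i v := u_1 \dots u_{i-1} \max(u_i,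 v_1) \dots \max(u_i, v_m) u_{i+1} \dots u_n$, the operations $\dashv_a$ and $\vdash_a$ corresponding to $0a$ and $a0$. Free over one generator is meant in the category of $\gamma$-pluriassociative algebras (morphisms: linear maps commuting with all operations). *)

(* Defs.v *)
From HB Require Import structures.
From mathcomp Require Import all_boot all_order all_algebra.
From mathcomp.multinomials Require Export freeg.

Set Implicit Arguments.
Unset Strict Implicit.
Unset Printing Implicit Defensive.

Import Order.TTheory GRing.Theory.

Local Open Scope ring_scope.

(* The set [gamma] = {1, ..., gamma} of indices is encoded as 'I_gamma, with
   i : 'I_gamma standing for the positive integer i + 1; this shift preserves
   the order, hence maxima. Letters are the elements of 'I_gamma.+1, that is
   {0, ..., gamma}, and [letter a] is the index a seen as a nonzero letter. *)
Definition letter (gamma : nat) (a : 'I_gamma) : 'I_gamma.+1 := fintype.lift ord0 a.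

Section PluriassociativeAlgebra.

Variables (K : fieldType) (gamma : nat).

Record pluriassociative (V : lmodType K) (dashv vdash : 'I_gamma -> V -> V -> V) :
    Prop := Pluriassociative {
  dashv_bilinear : forall a : 'I_gamma, bilinear_for *:%R *:%R (dashv a);
  vdash_bilinear : forall a : 'I_gamma, bilinear_for *:%R *:%R (vdash a);
  vdash_dashvA : forall (a a' : 'I_gamma) x y z,
    dashv a (vdash a' x y) z = vdash a' x (dashv a y z);
  dashv_max_vdash : forall (a a' : 'I_gamma) x y z,
    dashv a (dashv (Order.max a a') x y) z = dashv a x (vdash a' y z);
  vdash_max_dashv : forall (a a' : 'I_gamma) x y z,
    vdash a (dashv a' x y) z = vdash a x (vdash (Order.max a a') y z);
  dashv_max : forall (a a' : 'I_gamma) x y z,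
    dashv (Order.max a a') (dashv a x y) z = dashv a x (dashv a' y z);
  vdash_max : forall (a a' : 'I_gamma) x y z,
    vdash a (vdash a' x y) z = vdash (Order.max a a') x (vdash a y z) }.

Definition pluriassociative_morphism (V W : lmodType K)
    (dashvV vdashV : 'I_gamma -> V -> V -> V) (dashvW vdashW : 'I_gamma -> W -> W -> W)
    (phi : {linear V -> W}) : Prop :=
  forall a x y, phi (dashvV a x y) = dashvW a (phi x) (phi y) /\
                phi (vdashV a x y) = vdashW a (phi x) (phi y).

Definition free_generator (V : lmodType K) (dashv vdash : 'I_gamma -> V -> V -> V)
    (e : V) : Prop :=
  forall (W : lmodType K) (dashvW vdashW : 'I_gamma -> W -> W -> W),
    pluriassociative dashvW vdashW ->
  forall x : W, exists phi : {linear V -> W},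
    [/\ pluriassociative_morphism dashv vdash dashvW vdashW phi,
        phi e = x
      & forall psi : {linear V -> W},
          pluriassociative_morphism dashv vdash dashvW vdashW psi ->
          psi e = x -> psi =1 phi].

Definition free_pluriassociative_on_one_generator
    (V : lmodType K) (dashv vdash : 'I_gamma -> V -> V -> V) : Prop :=
  pluriassociative dashv vdash /\ exists e : V, free_generator dashv vdash e.

End PluriassociativeAlgebra.

(* Such a word is automatically nonempty. *)
Definition dias_word (gamma : nat) : Type :=
  {w : seq 'I_gamma.+1 | count_mem ord0 w == 1%N}.

HB.instance Definition _ gamma := SubChoice.on (dias_word gamma).

Section WordAlgebra.

Variable gamma : nat.

Definition hword (a : 'I_gamma) (w : seq 'I_gamma.+1) : seq 'I_gamma.+1 :=
  [seq (if (b < letter a)%N then letter a else b) | b : 'I_gamma.+1 <- w].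

Lemma count0_hword (a : 'I_gamma) (w : seq 'I_gamma.+1) :
  count_mem ord0 (hword a w) = 0%N.
Proof.
rewrite /hword count_map; elim: w => //= b w ->; rewrite addn0.
by case: ltnP => //; case: eqP => // ->.
Qed.

Fact dashv_word_subproof (a : 'I_gamma) (u v : dias_word gamma) :
  count_mem ord0 (val u ++ hword a (val v)) == 1%N.
Proof. by rewrite count_cat count0_hword addn0 (valP u). Qed.

Fact vdash_word_subproof (a : 'I_gamma) (u v : dias_word gamma) :
  count_mem ord0 (hword a (val u) ++ val v) == 1%N.
Proof. by rewrite count_cat count0_hword (valP v). Qed.

Definition dashv_word (a : 'I_gamma) (u v : dias_word gamma) : dias_word gamma :=
  Sub (val u ++ hword a (val v)) (dashv_word_subproof a u v).

Definition vdash_word (a : 'I_gamma) (u v : dias_word gamma) : dias_word gamma :=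
  Sub (hword a (val u) ++ val v) (vdash_word_subproof a u v).

Variable K : fieldType.

Definition word_space : lmodType K := {freeg (dias_word gamma) / K}.

(* The bilinear extension of an operation on words. *)
Definition extend2 (op : dias_word gamma -> dias_word gamma -> dias_word gamma)
    (x y : word_space) : word_space :=
  fglift (fun u => fglift (fun v => << op u v >> : word_space) y) x.

Definition word_dashv (a : 'I_gamma) : word_space -> word_space -> word_space :=
  extend2 (dashv_word a).

Definition word_vdash (a : 'I_gamma) : word_space -> word_space -> word_space :=
  extend2 (vdash_word a).

End WordAlgebra.

(* Main.v *)
(* The words form an algebra because h_a h_b = h_(max a b). The generator is
   the one-letter word 0, and every word is obtained from it by adding letters
   one at a time, on the left with [a w = 0 |-_a w] and on the right with
   [w a = w -|_a 0]; this gives uniqueness. For existence, a word is sent to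
   the corresponding iterated product. The order in which left and right letters
   are added is irrelevant by the axiom (x |- y) -| z = x |- (y -| z), and
   u -|_a v (resp. u |-_a v) is handled by induction on v (resp. u), since the
   other four axioms reduce a product with [0 |-_b v] or [v -|_b 0] to two
   products with smaller words. *)

Require Import Defs.
From HB Require Import structures.
From mathcomp Require Import all_boot all_order all_algebra.
From mathcomp Require Import zify.

Set Implicit Arguments.
Unset Strict Implicit.
Unset Printing Implicit Defensive.

Import Order.TTheory GRing.Theory.

Local Open Scope ring_scope.

(** * Linear maps out of a free module *)

Section FreegLift.

Variables (R : nzRingType) (T : choiceType) (M : lmodType R).
Implicit Types (f : T -> M) (D : {freeg T / R}).

HB.instance Definition _ f :=
  GRing.isAdditive.Build {freeg T / R} M (fglift f) (lift_is_additive f).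

Lemma fglift_sum f D : fglift f D = \sum_(x <- dom D) coeff x D *: f x.
Proof.
rewrite -{1}(freeg_sumE D) raddf_sum.
by apply: eq_bigr => x _; rewrite /= liftU.
Qed.

Lemma fglift_is_scalable f : scalable (fglift f).
Proof.
(* Scaling is by definition a sum of one-term elements over [dom D], so additivity of the lift is
   enough. *)
move=> c D; rewrite -[c *: D]/(fgscale c D) /fgscale.
rewrite raddf_sum fglift_sum scaler_sumr.
by apply: eq_bigr => x _; rewrite /= liftU scalerA.
Qed.

HB.instance Definition _ f :=
  GRing.isScalable.Build R {freeg T / R} M *:%R (fglift f) (fglift_is_scalable f).

Lemma fgliftU1 f x : fglift f << x >> = f x.
Proof. by rewrite liftU scale1r. Qed.

Lemma eq_fglift f g : f =1 g -> fglift f =1 fglift g.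
Proof. by move=> fg D; rewrite !fglift_sum; apply: eq_bigr => x _; rewrite fg. Qed.

Lemma linear_fgliftE (h : {freeg T / R} -> M) :
  linear h -> h =1 fglift (fun x => h << x >>).
Proof.
move=> lin_h D; pose H : {linear {freeg T / R} -> M} :=
  HB.pack h (GRing.isLinear.Build _ _ _ _ _ lin_h).
rewrite fglift_sum -{1}(freeg_sumE D) -[LHS]/(H _) raddf_sum.
apply: eq_bigr => x _; rewrite -[RHS](linearZ_LR H); congr (H _).
by apply/eqP/freeg_eqP => y; rewrite coeffZ !coeffU mul1r.
Qed.

Lemma freeg_linear_ext (h k : {freeg T / R} -> M) :
  linear h -> linear k -> (forall x, h << x >> = k << x >>) -> h =1 k.
Proof.
move=> lin_h lin_k hk D.
by rewrite (linear_fgliftE lin_h) (linear_fgliftE lin_k); apply: eq_fglift.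
Qed.

End FreegLift.

(** * The identities and the induction principle on words *)

Section Words.

Variable gamma : nat.
Implicit Types (a b : 'I_gamma) (u v w : dias_word gamma).

Lemma hword_cat a (s t : seq 'I_gamma.+1) :
  hword a (s ++ t) = hword a s ++ hword a t.
Proof. exact: map_cat. Qed.

(** On each letter [hword a] is the maximum with [letter a], and maximum is associative. *)
Lemma hword_hword a b (s : seq 'I_gamma.+1) :
  hword a (hword b s) = hword (Order.max a b) s.
Proof.
rewrite /hword -map_comp; apply: eq_map => c /=; apply: val_inj.
rewrite /letter maxEle leEord.
by repeat case: ifP => /=; rewrite /bump /=; lia.
Qed.

Definition dias_unit : dias_word gamma :=
  exist (fun s => count_mem ord0 s == 1%N) [:: ord0] isT.

Lemma vdash_dashv_wordA a b u v w :
  dashv_word a (vdash_word b u v) w = vdash_word b u (dashv_word a v w).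
Proof. by apply: val_inj; rewrite /= catA. Qed.

Lemma dashv_max_vdash_word a b u v w :
  dashv_word a (dashv_word (Order.max a b) u v) w =
  dashv_word a u (vdash_word b v w).
Proof. by apply: val_inj; rewrite /= hword_cat hword_hword catA. Qed.

Lemma vdash_max_dashv_word a b u v w :
  vdash_word a (dashv_word b u v) w =
  vdash_word a u (vdash_word (Order.max a b) v w).
Proof. by apply: val_inj; rewrite /= hword_cat hword_hword catA. Qed.

Lemma dashv_max_word a b u v w :
  dashv_word (Order.max a b) (dashv_word a u v) w =
  dashv_word a u (dashv_word b v w).
Proof. by apply: val_inj; rewrite /= hword_cat hword_hword catA. Qed.

Lemma vdash_max_word a b u v w :
  vdash_word a (vdash_word b u v) w =
  vdash_word (Order.max a b) u (vdash_word a v w).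
Proof. by apply: val_inj; rewrite /= hword_cat hword_hword catA. Qed.

(** Letters are removed from the left until the 0 comes first, then from the right. *)
Lemma dias_word_ind (P : dias_word gamma -> Prop) :
  P dias_unit ->
  (forall a w, P w -> P (vdash_word a dias_unit w)) ->
  (forall a w, P w -> P (dashv_word a w dias_unit)) ->
  forall w, P w.
Proof.
move=> P0 Pl Pr [s]; elim: s => // c s IHs cs.
case: (unliftP ord0 c) => [a|] def_c.
  have s1 : count_mem ord0 s == 1%N by have := cs; rewrite def_c.
  rewrite (_ : exist _ _ _ = vdash_word a dias_unit (exist _ s s1)).
    exact/Pl/IHs.
  by apply: val_inj; rewrite /= def_c.
(* The 0 now stands at the head, so a last letter [d] equal to 0 would be a second occurrence. *)
subst c; elim/last_ind: s {IHs} cs => [|s d IHs] cs.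
  by rewrite (_ : exist _ _ _ = dias_unit) //; apply: val_inj.
case: (unliftP ord0 d) => [a|] def_d.
  have s1 : count_mem ord0 (ord0 :: s) == 1%N.
    by have := cs; rewrite def_d -cats1 /= count_cat /= !addn0.
  rewrite (_ : exist _ _ _ = dashv_word a (exist _ (ord0 :: s) s1) dias_unit).
    exact/Pr/IHs.
  by apply: val_inj; rewrite /= def_d -cats1.
by exfalso; move: cs; rewrite def_d -cats1 /= count_cat /= add1n addn1.
Qed.

End Words.

(** * Extension of the identities from words to their span *)

Section WordAlgebra.

Variables (gamma : nat) (K : fieldType).
Implicit Types (op : dias_word gamma -> dias_word gamma -> dias_word gamma).

Lemma extend2_linearl op (y : word_space gamma K) : linear (extend2 op ^~ y).
Proof. by move=> c x1 x2; rewrite /extend2 linearP. Qed.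

Lemma extend2_linearr op (x : word_space gamma K) : linear (extend2 op x).
Proof.
move=> c y1 y2; rewrite /extend2 !fglift_sum scaler_sumr -big_split.
(* Commutativity of [K] exchanges [c] with the coefficient of [u] in [x]. *)
by apply: eq_bigr => u _; rewrite linearP scalerDr !scalerA mulrC.
Qed.

Lemma extend2U op u v :
  extend2 op << u >> << v >> = << op u v >> :> word_space gamma K.
Proof. by rewrite /extend2 !fgliftU1. Qed.

(** Both sides are trilinear, so each variable in turn may be taken to be a word. Four independent
    operations let one statement cover all five axioms. *)
Lemma extend2_assoc op1 op2 op3 op4 :
  (forall u v w, op1 (op2 u v) w = op3 u (op4 v w)) ->
  forall x y z : word_space gamma K,
    extend2 op1 (extend2 op2 x y) z = extend2 op3 x (extend2 op4 y z).
Proof.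
move=> opA x y z.
have linE := (extend2_linearl, extend2_linearr).
apply: (freeg_linear_ext (h := fun x => extend2 op1 (extend2 op2 x y) z)
  (k := fun x => extend2 op3 x (extend2 op4 y z))) => [c s t|c s t|u].
- by rewrite !linE.
- by rewrite !linE.
apply: (freeg_linear_ext (h := fun y => extend2 op1 (extend2 op2 << u >> y) z)
  (k := fun y => extend2 op3 << u >> (extend2 op4 y z))) => [c s t|c s t|v].
- by rewrite !linE.
- by rewrite !linE.
apply: (freeg_linear_ext
  (h := extend2 op1 (extend2 op2 << u >> << v >>))
  (k := fun z => extend2 op3 << u >> (extend2 op4 << v >> z)))
  => [c s t|c s t|w].
- by rewrite !linE.
- by rewrite !linE.
by rewrite !extend2U opA.
Qed.

Lemma word_pluriassociative :
  pluriassociative (@word_dashv gamma K) (@word_vdash gamma K).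
Proof.
split=> [a|a|a b|a b|a b|a b|a b].
1,2: by split=> x; [apply: extend2_linearl | apply: extend2_linearr].
all: apply: extend2_assoc => u v w.
- exact: vdash_dashv_wordA.
- exact: dashv_max_vdash_word.
- exact: vdash_max_dashv_word.
- exact: dashv_max_word.
- exact: vdash_max_word.
Qed.

End WordAlgebra.

(** * Evaluation of words in an arbitrary algebra *)

Section Evaluation.

Variables (K : fieldType) (gamma : nat) (W : lmodType K).
Variables (dashv vdash : 'I_gamma -> W -> W -> W).
Hypothesis assocW : pluriassociative dashv vdash.
Variable x : W.
Implicit Types (a : 'I_gamma) (s : seq 'I_gamma.+1) (u v w : dias_word gamma).

(** The value at the letter 0 is a default: in a word with a single 0, only nonzero letters follow
    it. *)
Definition right_step (y : W) (c : 'I_gamma.+1) : W :=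
  if unlift ord0 c is Some a then dashv a y x else y.

(* u_1 ... u_k 0 v_1 ... v_l is sent to
   u_1 |- (... (u_k |- ((x -| v_1) ... -| v_l))), where u_i |- y and y -| v_j
   stand for [vdash u_i x y] and [dashv v_j y x]; on a word without 0 the
   value is meaningless. *)
Fixpoint eval_seq s : W :=
  if s is c :: s' then
    if unlift ord0 c is Some a then vdash a x (eval_seq s')
    else foldl right_step x s'
  else 0.

Definition eval_word w : W := eval_seq (val w).

Lemma eval_word_unit : eval_word (dias_unit gamma) = x.
Proof. by rewrite /eval_word /= unlift_none. Qed.

Lemma eval_word_vdash_unit a w :
  eval_word (vdash_word a (dias_unit gamma) w) = vdash a x (eval_word w).
Proof. by rewrite /eval_word /= liftK. Qed.

(** Left letters are the outermost operations in [eval_seq]; the axiom [vdash_dashvA] carries the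
    new right factor inside them, down to the fold started at the 0. *)
Lemma eval_seq_rcons a s :
  ord0 \in s -> eval_seq (rcons s (letter a)) = dashv a (eval_seq s) x.
Proof.
elim: s => // c s IHs; rewrite inE /=.
case: unliftP => [b ->|_ _] /=; last by rewrite foldl_rcons /right_step liftK.
by rewrite (vdash_dashvA assocW) => /IHs ->.
Qed.

Lemma eval_word_dashv_unit a w :
  eval_word (dashv_word a w (dias_unit gamma)) = dashv a (eval_word w) x.
Proof.
rewrite /eval_word /= cats1 eval_seq_rcons //.
by rewrite -has_pred1 has_count (eqP (valP w)).
Qed.

Lemma eval_word_dashv a u v :
  eval_word (dashv_word a u v) = dashv a (eval_word u) (eval_word v).
Proof.
(* [u] has to vary: when a left letter [b] is removed from the right operand, the hypothesis is
   applied with [dashv_word (Order.max a b) u (dias_unit gamma)] as left operand. *)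
elim/dias_word_ind: v a u => [|b v IHv|b v IHv] a u.
- by rewrite eval_word_dashv_unit eval_word_unit.
- rewrite -dashv_max_vdash_word IHv eval_word_dashv_unit eval_word_vdash_unit.
  by rewrite (dashv_max_vdash assocW).
- rewrite -dashv_max_word !eval_word_dashv_unit IHv.
  by rewrite (dashv_max assocW).
Qed.

Lemma eval_word_vdash a u v :
  eval_word (vdash_word a u v) = vdash a (eval_word u) (eval_word v).
Proof.
(* Symmetrically, removing a right letter from [u] enlarges [v]. *)
elim/dias_word_ind: u a v => [|b u IHu|b u IHu] a v.
- by rewrite eval_word_vdash_unit eval_word_unit.
- rewrite vdash_max_word !eval_word_vdash_unit IHu.
  by rewrite (vdash_max assocW).
- rewrite vdash_max_dashv_word IHu eval_word_dashv_unit eval_word_vdash_unit.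
  by rewrite (vdash_max_dashv assocW).
Qed.

(** Both sides are bilinear, so compatibility on words suffices. *)
Lemma fglift_extend2 op (opW : W -> W -> W) (f : dias_word gamma -> W) :
  bilinear_for *:%R *:%R opW ->
  (forall u v, f (op u v) = opW (f u) (f v)) ->
  forall y z : word_space gamma K,
    fglift f (extend2 op y z) = opW (fglift f y) (fglift f z).
Proof.
move=> [opWl opWr] fM y z.
apply: (freeg_linear_ext (h := fun y => fglift f (extend2 op y z))
  (k := fun y => opW (fglift f y) (fglift f z))) => [c s t|c s t|u].
- by rewrite extend2_linearl linearP.
- by rewrite linearP opWl.
apply: (freeg_linear_ext (h := fun z => fglift f (extend2 op << u >> z))
  (k := fun z => opW (fglift f << u >>) (fglift f z))) => [c s t|c s t|v].
- by rewrite extend2_linearr linearP.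
- by rewrite linearP opWr.
by rewrite extend2U !fgliftU1.
Qed.

Lemma fglift_eval_word_morphism :
  pluriassociative_morphism (@word_dashv gamma K) (@word_vdash gamma K)
    dashv vdash (fglift eval_word).
Proof.
move=> a y z; split; apply: fglift_extend2.
- exact: dashv_bilinear assocW a.
- exact: eval_word_dashv.
- exact: vdash_bilinear assocW a.
- exact: eval_word_vdash.
Qed.

Lemma morphism_word_unique (psi : {linear word_space gamma K -> W}) :
  pluriassociative_morphism (@word_dashv gamma K) (@word_vdash gamma K)
    dashv vdash psi ->
  psi << dias_unit gamma >> = x -> psi =1 fglift eval_word.
Proof.
move=> psiM psi0; apply: freeg_linear_ext => [||w]; [exact: linearP..|].
rewrite fgliftU1; elim/dias_word_ind: w => [|a w IHw|a w IHw].
- by rewrite psi0 eval_word_unit.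
(* Writing [x] as the image of the generator turns the product in [W] into [psi] of a product of
   words. *)
- by rewrite eval_word_vdash_unit -IHw -psi0 -(psiM a _ _).2 /word_vdash extend2U.
- by rewrite eval_word_dashv_unit -IHw -psi0 -(psiM a _ _).1 /word_dashv extend2U.
Qed.

End Evaluation.

Theorem proposition3p1p1 (K : fieldType) (charK : [pchar K]%R =i pred0)
    (gamma : nat) :
  free_pluriassociative_on_one_generator
    (@word_dashv gamma K) (@word_vdash gamma K).
Proof.
split; first exact: word_pluriassociative.
exists << dias_unit gamma >> => W dashvW vdashW assocW x.
exists (fglift (eval_word dashvW vdashW x)); split.
- exact: fglift_eval_word_morphism.
- by rewrite /= fgliftU1 eval_word_unit.
- exact: morphism_word_unique.
Qed.
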